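(* For each $n\ge 0$ there exists a bijection between the set of $(2^m-1)$-color compositions of $n+1$ and the set of $4$-ary words of length $n$ in which the strings $1$-$3$ and $2$-$4$ do not occur.
   Context: A composition of a positive integer $N$ is a finite sequence of positive integers (parts) summing to $N$. A $(2^m-1)$-color composition of $N$ is a composition of $N$ in which each part of size $i$ is assigned one of $2^i-1$ colors (for each $i\ge 1$). A $4$-ary word of length $n$ is a sequence $w_1\cdots w_n\in\{1,2,3,4\}^n$; the string $a$-$b$ occurs in it if $w_i=a$ and $w_{i+1}=b$ for some $1\le i\le n-1$ (consecutive positions). *)

(* Defs.v *)
From mathcomp Require Import all_boot.

Set Implicit Arguments.
Unset Strict Implicit.
Unset Printing Implicit Defensive.

(* A coloured part is a pair (size, colour); when c i colours are available
   for the parts of size i, they are numbered 1, ..., c i. *)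
Definition is_color_composition (c : nat -> nat) (N : nat)
    (s : seq (nat * nat)) : bool :=
  [&& all (fun p => 0 < p.1) s,
      all (fun p => 0 < p.2 <= c p.1) s
    & sumn [seq p.1 | p <- s] == N].

Definition color_composition (c : nat -> nat) (N : nat) : Type :=
  {s : seq (nat * nat) | is_color_composition c N s}.

(* [infix] is containment as a contiguous block. *)
Definition is_avoiding_word (n : nat) (w : n.-tuple nat) : bool :=
  [&& all (fun a => 1 <= a <= 4) w,
      ~~ infix [:: 1; 3] w
    & ~~ infix [:: 2; 4] w].

Definition avoiding_word (n : nat) : Type :=
  {w : n.-tuple nat | is_avoiding_word w}.

(* Main.v *)
Require Import Defs.
From mathcomp Require Import all_boot zify.

(** Lay the n+1 units of a composition out as n+1 cells, and number the colours
    of a part of size m by the nonzero m-bit integers, the first cell of the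
    part carrying the lowest bit.  A composition is then a row of n+1 bits in
    which some of the n gaps between cells are bars, every block having a
    nonzero bit.  Call a composition odd when its first bit is 1.

    A composition of size at least 2 arises from a smaller one, by adding a
    first cell, in exactly one of four ways:
    - a new part of size 1 and colour 1 is put in front of any composition
      (the new cell is 1, followed by a bar);
    - the first part of any composition is extended by a bit 0, so that its
      colour c becomes 2c;
    - the first part of an odd composition is extended by a bit 1, so that
      c becomes 2c + 1, and the bit that follows is then kept equal to 1 or is
      reset to 0, so that c becomes 2c - 1.
    The result is odd except in the second way.  Thus two of the four ways start
    from an arbitrary composition and two from an odd one; for an odd result
    these numbers are one and two.

    Words behave in the same way.  With no constraint from the left, a word
    starts with 3 or 4 and goes on unconstrained, or starts with 1 or 2 and
    goes on under a constraint; under a constraint one of 3 and 4 is excluded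
    (3 after 1, 4 after 2).  So let constrained words code odd compositions: the
    letters 1 and 2 record the two extensions by a bit 1; without a constraint
    3 records the new part and 4 the extension by a bit 0; under a constraint
    the one of 3 and 4 that is left records the new part.  The maps [decode] and
    [encode] follow these two recursions, with the preceding letter as an
    argument; [decodeP] and [encodeP] show that they are well defined and
    mutually inverse. *)

Set Implicit Arguments.
Unset Strict Implicit.
Unset Printing Implicit Defensive.

Local Notation is_comp := (is_color_composition (fun m => 2 ^ m - 1)).

(** * Avoidance as a path condition *)

Definition may_follow (p a : nat) : bool :=
  (1 <= a <= 4) && ((p, a) \notin [:: (1, 3); (2, 4)]).

(** The starting value 0 stands for the absence of a preceding letter. *)
Lemma avoiding_path n (w : n.-tuple nat) :
  is_avoiding_word w = path may_follow 0 w.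
Proof.
have avoid p (v : seq nat) : path may_follow p v =
    [&& all (fun a => 1 <= a <= 4) v, ~~ infix [:: 1; 3] (p :: v)
      & ~~ infix [:: 2; 4] (p :: v)].
  elim: v p => [|a v IHv] p; first by rewrite /= !andbF.
  rewrite [LHS]/= IHv /may_follow ![infix _ (p :: _)]/=.
  rewrite !prefix0s !inE !xpair_eqE !andbT !negb_or ![_ == p]eq_sym ![_ == a]eq_sym.
  by rewrite [all _ (a :: v)]/= -!andbA; do !bool_congr.
by rewrite avoid /is_avoiding_word; case: (tval w).
Qed.

(** * The two codings *)

Definition extend (f : nat -> nat) (s : seq (nat * nat)) : seq (nat * nat) :=
  if s is (m, c) :: s' then (m.+1, f c) :: s' else [::].

Definition odd_first (s : seq (nat * nat)) : bool := odd (head (0, 0) s).2.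

(** The letters after which the next one is constrained; they are also those
    that have to be followed by the code of an odd composition. *)
Definition constrains (p : nat) : bool := p \in [:: 1; 2].

Fixpoint decode (p : nat) (w : seq nat) : seq (nat * nat) :=
  if w is a :: w' then
    let s := decode a w' in
    if a == 1 then extend (fun c => c.*2.-1) s
    else if a == 2 then extend (fun c => c.*2.+1) s
    else if (a == 4) && (p != 1) then extend double s
    else (1, 1) :: s
  else [:: (1, 1)].

(** The first argument is the preceding letter, the second one the number of
    letters to be written. *)
Fixpoint encode (p n : nat) (s : seq (nat * nat)) : seq nat :=
  match n, s with
  | n'.+1, (m, c) :: s' =>
    if m == 1 then
      let a := if p == 1 then 4 else 3 in a :: encode a n' s'
    else if ~~ odd c then 4 :: encode 4 n' ((m.-1, c./2) :: s')
    else if odd c./2 then 2 :: encode 2 n' ((m.-1, c./2) :: s')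
    else 1 :: encode 1 n' ((m.-1, c./2.+1) :: s')
  | _, _ => [::]
  end.

Lemma is_comp_cons N m c s :
  is_comp N ((m, c) :: s) =
  [&& 0 < m, 0 < c, c < 2 ^ m, m <= N & is_comp (N - m) s].
Proof.
rewrite /is_color_composition /=.
have := expn_gt0 2 m; rewrite /= => pos.
case: (all _ s) => /=; last by rewrite !andbF.
case: (all _ s) => /=; last by rewrite !andbF.
lia.
Qed.

Lemma is_comp0 s : is_comp 0 s -> s = [::].
Proof. by case: s => [|[m c] s] //; rewrite is_comp_cons; lia. Qed.

Lemma is_comp_extend N m c d s : is_comp N ((m, c) :: s) ->
  0 < d <= c.*2.+1 -> is_comp N.+1 ((m.+1, d) :: s).
Proof.
rewrite !is_comp_cons subSS expnS => /and5P[m0 c0 cm mN ->] dc.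
by rewrite andbT; lia.
Qed.

(** Oddness after a constraining letter is what makes [c.*2.-1] a positive
    number congruent to 1 modulo 4, so that it is told apart from the values
    [c.*2.+1], which are then congruent to 3. *)
Lemma decodeP p w : path may_follow p w ->
  [/\ is_comp (size w).+1 (decode p w), constrains p -> odd_first (decode p w)
    & encode p (size w) (decode p w) = w].
Proof.
elim: w p => [//|a w IHw] p /= /andP[pa /IHw[]].
case def_s: (decode a w) => [|[m c] s]; first by [].
move=> comp_s odd_s enc_s.
have [m0 c0] : 0 < m /\ 0 < c by move: comp_s; rewrite is_comp_cons; lia.
have [a1|a1] := eqVneq a 1.
  have codd : odd c by apply: odd_s; rewrite a1.
  have -> : extend (fun c => c.*2.-1) ((m, c) :: s) = (m.+1, c.*2.-1) :: s by [].
  split; first by apply: is_comp_extend comp_s _; lia.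
    by move=> _; rewrite /odd_first /=; lia.
  have [h1 h2] : (m.+1 == 1) = false /\ odd c.*2.-1 by lia.
  have h3 : c.*2.-1./2 = c.-1 by lia.
  have h4 : odd c.-1 = false by lia.
  by rewrite h1 h2 h3 h4 /= prednK // -a1 enc_s.
have [a2|a2] := eqVneq a 2.
  have codd : odd c by apply: odd_s; rewrite a2.
  split; first by apply: is_comp_extend comp_s _; lia.
    by move=> _; rewrite /odd_first /= odd_double.
  have h1 : (m.+1 == 1) = false by lia.
  by rewrite /= h1 odd_double /= uphalf_double codd -a2 enc_s.
case: ifP => [/andP[/eqP a4 p1]|a4].
  split; first by apply: is_comp_extend comp_s _; lia.
    move: pa; rewrite a4 /may_follow /constrains !inE !xpair_eqE /= andbT.
    by rewrite (negPf p1) /= => /negPf ->.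
  have h1 : (m.+1 == 1) = false by lia.
  by rewrite /= h1 odd_double /= doubleK -a4 enc_s.
split; first by rewrite is_comp_cons subn1.
  by [].
have def_a : (if p == 1 then 4 else 3) = a.
  by move: pa a4; rewrite /may_follow !inE !xpair_eqE; case: (p =P 1); lia.
by rewrite /= def_a enc_s.
Qed.

Lemma encodeP p n s : is_comp n.+1 s -> (constrains p -> odd_first s) ->
  [/\ path may_follow p (encode p n s), size (encode p n s) = n
    & decode p (encode p n s) = s].
Proof.
elim: n p s => [|n IHn] p [|[m c] s] //.
  rewrite is_comp_cons => /and5P[m0 c0 cm mN].
  have m1 : m = 1 by lia.
  rewrite m1 in cm *; move=> /is_comp0 -> _.
  by have -> : c = 1 by lia.
move=> comp_s odd_s.
move: (comp_s); rewrite is_comp_cons => /and5P[m0 c0 cm mN rest].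
have [m1|m1] := eqVneq m 1.
  rewrite m1 /= in cm rest *.
  have -> : c = 1 by lia.
  set a := if _ then _ else _.
  have [||av sz dec_s] := IHn a s.
  - by rewrite subn1 in rest.
  - by rewrite /a; case: ifP.
  have pa : may_follow p a.
    by rewrite /a /may_follow !inE !xpair_eqE; case: (p =P 1); lia.
  rewrite /= dec_s pa av sz; split=> //.
  by rewrite /a; case: (p == 1).
case: m m1 m0 cm mN rest comp_s odd_s => [//|m] m1 _ cm mN rest comp_s odd_s.
rewrite [encode _ _ _]/= (negPf m1).
rewrite expnS in cm.
have shrink d : 0 < d < 2 ^ m -> is_comp n.+1 ((m, d) :: s).
  by rewrite is_comp_cons; move: rest; rewrite subSS => ->; lia.
(* If c./2 is even and less than 2 ^ m, then its successor is less than 2 ^ m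
   too, by parity. *)
have pow_even : 2 ^ m = (2 ^ m.-1).*2 by rewrite -{1}[m]prednK ?expnS; lia.
case: ifP => [ev|/negbFE od].
  have np : constrains p = false by apply/negP => /odd_s; apply/negP.
  have [||av sz dec_s] := IHn 4 ((m, c./2) :: s); try by [].
    by apply: shrink; lia.
  have pa : may_follow p 4.
    by move: np; rewrite /may_follow /constrains !inE !xpair_eqE; lia.
  rewrite /= pa av sz dec_s; split=> //.
  have -> : p != 1 by apply/eqP=> p1; rewrite p1 in np.
  by rewrite /=; congr ((_, _) :: _); lia.
case: ifP => [od2|ev2].
  have [||av sz dec_s] := IHn 2 ((m, c./2) :: s); try by [].
    by apply: shrink; lia.
  have pa : may_follow p 2 by rewrite /may_follow !inE !xpair_eqE; lia.
  by rewrite /= pa av sz dec_s; split=> //; congr ((_, _) :: _); lia.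
have [||av sz dec_s] := IHn 1 ((m, c./2.+1) :: s).
- by apply: shrink; lia.
- by move=> _; rewrite /odd_first /= ev2.
have pa : may_follow p 1 by rewrite /may_follow !inE !xpair_eqE; lia.
by rewrite /= pa av sz dec_s; split=> //; congr ((_, _) :: _); lia.
Qed.

(** * The bijection *)

Theorem proposition3p2 (n : nat) :
  exists f : color_composition (fun m => 2 ^ m - 1) n.+1 -> avoiding_word n,
    bijective f.
Proof.
have enc (s : color_composition (fun m => 2 ^ m - 1) n.+1) :
    {w : avoiding_word n | val (val w) = encode 0 n (val s)}.
  case: s => s comp_s; have [|av /eqP sz _] := encodeP (p := 0) comp_s.
    by [].
  have avw : is_avoiding_word (Tuple sz) by rewrite avoiding_path.
  by exists (exist _ (Tuple sz) avw).
have dec (w : avoiding_word n) :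
    {s : color_composition (fun m => 2 ^ m - 1) n.+1 |
      val s = decode 0 (val (val w))}.
  case: w => w av.
  have /decodeP[comp_s _ _] : path may_follow 0 w by rewrite -avoiding_path.
  by rewrite size_tuple in comp_s; exists (exist _ (decode 0 w) comp_s).
exists (fun s => sval (enc s)), (fun w => sval (dec w)) => [s|w].
  apply: val_inj; case: (dec _) => /= s' ->; case: (enc s) => /= w ->.
  by case: s => s comp_s; case: (encodeP (p := 0) comp_s).
apply: val_inj; apply: val_inj.
case: (enc _) => /= w' ->; case: (dec w) => /= s ->.
case: w => w av.
have /decodeP[_ _] : path may_follow 0 w by rewrite -avoiding_path.
by rewrite size_tuple.
Qed.
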